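(* Let $m,n\ge 2$ be integers, let $\mathcal{A}\in T_{m,n}$ and let $P=[p_{ij}]_{n\times n}$ be a permutation matrix of order $n$. Then $\mathcal{A}$ is a column adequate tensor if and only if $P^T\mathcal{A}P$ is a column adequate tensor.
   Context: $[n]=\{1,\dots,n\}$. $T_{m,n}$ denotes the set of real tensors $\mathcal{A}=(a_{i_1 i_2\cdots i_m})$ of order $m$ and dimension $n$, with $i_j\in[n]$ for $j\in[m]$. For $x\in\mathbb{R}^n$, $\mathcal{A}x^{m-1}\in\mathbb{R}^n$ is the vector with components $(\mathcal{A}x^{m-1})_i=\sum_{i_2,\dots,i_m=1}^n a_{i i_2\cdots i_m}x_{i_2}\cdots x_{i_m}$, $i\in[n]$. Column adequate tensor: $\mathcal{A}\in T_{m,n}$ is column adequate if, for every $x\in\mathbb{R}^n$, $x_i(\mathcal{A}x^{m-1})_i\le 0$ for all $i\in[n]$ implies $\mathcal{A}x^{m-1}=0$. Product: $P^T\mathcal{A}P$ is formed with the general (Shao) tensor product; explicitly, it is the tensor $\mathcal{B}=(b_{i_1\cdots i_m})\in T_{m,n}$ with $b_{i_1i_2\cdots i_m}=\sum_{j_1,\dots,j_m\in[n]}p_{j_1i_1}a_{j_1j_2\cdots j_m}p_{j_2i_2}p_{j_3i_3}\cdots p_{j_mi_m}$. *)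

(* Defs.v *)
From mathcomp Require Import all_boot all_order all_algebra all_fingroup.
From mathcomp Require Import reals.

Set Implicit Arguments.
Unset Strict Implicit.
Unset Printing Implicit Defensive.

Import Order.TTheory GRing.Theory Num.Theory.
Local Open Scope ring_scope.

(* Entry a_{i_1 ... i_m} is A [tuple i_1; ...; i_m]; indices are 0-based. *)
Definition tensor (R : realType) (m n : nat) : Type :=
  {ffun m.-tuple 'I_n -> R}.

(* A x^{m-1}: the sum over i_2, ..., i_m is written as a sum over the index
   tuples t = (i, i_2, ..., i_m) whose first entry is i, so that
   behead t = (i_2, ..., i_m). Only meaningful for m >= 1. *)
Definition tensor_apply (R : realType) (m n : nat) (A : tensor R m n)
    (x : 'cV[R]_n) : 'cV[R]_n :=
  \col_i \sum_(t : m.-tuple 'I_n | ohead t == Some i)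
    A t * \prod_(k <- behead t) x k 0.

Definition column_adequate (R : realType) (m n : nat) (A : tensor R m n) : Prop :=
  forall x : 'cV[R]_n,
    (forall i : 'I_n, x i 0 * tensor_apply A x i 0 <= 0) ->
    tensor_apply A x = 0.

(* P^T A P for the general (Shao) tensor product:
   b_{i_1 ... i_m} =
     \sum_{j_1, ..., j_m} p_{j_1 i_1} a_{j_1 ... j_m} p_{j_2 i_2} ... p_{j_m i_m},
   with the factor p_{j_1 i_1} collected with the others. *)
Definition tensor_congr (R : realType) (m n : nat) (P : 'M[R]_n)
    (A : tensor R m n) : tensor R m n :=
  [ffun i : m.-tuple 'I_n =>
    \sum_(j : m.-tuple 'I_n) A j * \prod_(k < m) P (tnth j k) (tnth i k)].

(* Main.v *)
(** If [P] is the matrix of [s], then [P^T A P] is [A] with its indices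
    relabelled by [s], so [P^T A P] applied to [x] is the relabelling of [A]
    applied to the relabelled [x]; column adequacy is insensitive to this. The
    converse follows by congruence with the inverse permutation. *)
Require Import Defs.
From mathcomp Require Import all_boot all_order all_algebra all_fingroup.
From mathcomp Require Import reals.

Set Implicit Arguments.
Unset Strict Implicit.
Unset Printing Implicit Defensive.

Import Order.TTheory GRing.Theory Num.Theory.
Local Open Scope ring_scope.

Lemma map_tuple_permK (m n : nat) (s : 'S_n) :
  cancel (@map_tuple m _ _ s) (map_tuple (s^-1)%g).
Proof. by move=> t; apply/val_inj/mapK/permK. Qed.

Lemma map_tuple_permKV (m n : nat) (s : 'S_n) :
  cancel (@map_tuple m _ _ (s^-1)%g) (map_tuple s).
Proof. by move=> t; apply/val_inj/mapK/permKV. Qed.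

(** The entry of [perm_mx s] at [(j, i)] is 1 if [s j = i] and 0 otherwise, so the sum defining the
    congruence collapses to one term. *)
Lemma tensor_congr_perm (R : realType) (m n : nat) (s : 'S_n)
    (A : tensor R m n) (t : m.-tuple 'I_n) :
  tensor_congr (perm_mx s) A t = A (map_tuple (s^-1)%g t).
Proof.
rewrite ffunE (bigD1 (map_tuple (s^-1)%g t)) //= [X in _ * X]big1 => [|k _].
  rewrite mulr1 big1 ?addr0 // => u neq_u.
  (* At such a position [k] the matrix entry is 0, which kills the whole product for [u]. *)
  have [k neq_k] : exists k, s (tnth u k) != tnth t k.
    apply/existsP; apply: contraR neq_u; rewrite negb_exists => /forallP eq_su.
    apply/eqP/eq_from_tnth => k; rewrite tnth_map.
    by apply: (canRL (permK s)); apply/eqP; move: (eq_su k); rewrite negbK.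
  by rewrite (bigD1 k) //= !mxE (negbTE neq_k) mul0r mulr0.
by rewrite !mxE tnth_map permKV eqxx.
Qed.

(** Reindexing the sum by [s] turns each factor [x k 0] into [x (s k) 0], an entry of
    [row_perm s x]. Taking the component at [s i] keeps [s^-1] out of the formula. *)
Lemma tensor_apply_congr_perm (R : realType) (m n : nat) (s : 'S_n)
    (A : tensor R m n) (x : 'cV[R]_n) (i : 'I_n) :
  tensor_apply (tensor_congr (perm_mx s) A) x (s i) 0 =
  tensor_apply A (row_perm s x) i 0.
Proof.
rewrite !mxE (reindex (map_tuple s)) /=; last first.
  exists (map_tuple (s^-1)%g) => t _;
    [exact: map_tuple_permK | exact: map_tuple_permKV].
apply: eq_big => [t|t _].
  (* The range conditions agree because [s] is injective on heads; an empty tuple satisfies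
     neither. *)
  case: t => -[|j t] //= _; apply/eqP/eqP => [[/perm_inj ->]|[->]] //.
rewrite tensor_congr_perm map_tuple_permK behead_map big_map.
by congr (_ * _); apply: eq_bigr => k _; rewrite mxE.
Qed.

Lemma column_adequate_congr_perm (R : realType) (m n : nat) (s : 'S_n)
    (A : tensor R m n) :
  column_adequate A -> column_adequate (tensor_congr (perm_mx s) A).
Proof.
move=> adA x le0; have Ay0 : tensor_apply A (row_perm s x) = 0.
  (* The sign condition for [A] at [i] is the one for the congruence at [s i]. *)
  apply: adA => i; rewrite -tensor_apply_congr_perm [row_perm s x i 0]mxE.
  exact: le0.
apply/colP => i.
by rewrite -[i](permKV s) tensor_apply_congr_perm Ay0 !mxE.
Qed.

Lemma tensor_congr_permK (R : realType) (m n : nat) (s : 'S_n) :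
  cancel (@tensor_congr R m n (perm_mx s)) (tensor_congr (perm_mx (s^-1)%g)).
Proof.
by move=> A; apply/ffunP => t; rewrite !tensor_congr_perm invgK map_tuple_permK.
Qed.

Theorem theorem3p4 (R : realType) (m n : nat) (hm : (2 <= m)%N) (hn : (2 <= n)%N)
    (A : tensor R m n) (P : 'M[R]_n) (hP : is_perm_mx P) :
  column_adequate A <-> column_adequate (tensor_congr P A).
Proof.
have /is_perm_mxP[s ->] := hP.
split; first exact: column_adequate_congr_perm.
move=> /(@column_adequate_congr_perm _ _ _ (s^-1)%g).
by rewrite tensor_congr_permK.
Qed.
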